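(* Let $(\mathfrak g,[\,,])$ be a finite-dimensional real Lie algebra, $r\in\wedge^2\mathfrak g$ and $\varrho$ a Euclidean product on $\mathfrak g$. Let $S=\mathrm{Im}\, r_\#\subset\mathfrak g$, let $\omega_r\in\wedge^2S^*$ be the nondegenerate 2-form associated to $r$, and let $S^\perp$ be the $\varrho$-orthogonal of $S$, with orthogonal projections $\mathrm{pr}_S:\mathfrak g\to S$ and $\mathrm{pr}_{S^\perp}:\mathfrak g\to S^\perp$. Define $\phi_S:S\to\mathrm{End}(S^\perp)$, $\phi_S(s)=\mathrm{pr}_{S^\perp}\circ \mathrm{ad}_s|_{S^\perp}$, and $\phi_{S^\perp}:S^\perp\to\mathrm{End}(S)$, $\phi_{S^\perp}(u)=\mathrm{pr}_{S}\circ \mathrm{ad}_u|_{S}$. Then $(\mathfrak g,r,\varrho)$ is a Riemann-Poisson Lie algebra if and only if the following three conditions hold: 1. $(S,\varrho_{|S},\omega_r)$ is a Kähler Lie subalgebra, i.e., $S$ is a Lie subalgebra of $\mathfrak g$ and for all $s_1,s_2,s_3\in S$, $$\omega_r(\nabla_{s_1}s_2,s_3)+\omega_r(s_2,\nabla_{s_1}s_3)=0,$$ where $\nabla$ is the Levi-Civita product associated to $(S,[\,,],\varrho_{|S})$. 2. For all $s\in S$ and all $u,v\in S^\perp$, $\ \varrho(\phi_S(s)(u),v)+\varrho(u,\phi_S(s)(v))=0$. 3. For all $s_1,s_2\in S$ and all $u\in S^\perp$, $\ \omega_r(\phi_{S^\perp}(u)(s_1),s_2)+\omega_r(s_1,\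phi_{S^\perp}(u)(s_2))=0$.
   Context: Write $\prec\,,\succ$ for the duality pairing. For $r\in\wedge^2\mathfrak g$ (viewed as a skew bilinear form on $\mathfrak g^*$), $r_\#:\mathfrak g^*\to\mathfrak g$ is defined by $\prec\beta,r_\#(\alpha)\succ=r(\alpha,\beta)$. The associated 2-form on $S=\mathrm{Im}\,r_\#$ is $\omega_r(u,v)=r(\alpha,\beta)$ for any $\alpha,\beta$ with $r_\#(\alpha)=u$, $r_\#(\beta)=v$; it is well defined and nondegenerate. Define $[r,r]\in\wedge^3\mathfrak g$ by $$[r,r](\alpha,\beta,\gamma)=\prec\alpha,[r_\#(\beta),r_\#(\gamma)]\succ+\prec\beta,[r_\#(\gamma),r_\#(\alpha)]\succ+\prec\gamma,[r_\#(\alpha),r_\#(\beta)]\succ .$$ Define a bracket on $\mathfrak g^*$ by $[\alpha,\beta]_r=\mathrm{ad}^*_{r_\#(\alpha)}\beta-\mathrm{ad}^*_{r_\#(\beta)}\alpha$, where $\prec\mathrm{ad}^*_u\alpha,v\succ=-\prec\alpha,[u,v]\succ$ (it is a Lie bracket when $[r,r]=0$). Levi-Civita product: for a vector space $V$ with skew-symmetric bracket $[\,,]$ and Euclidean product $\varrho$, it is the bilinear map $A:V\times V\to V$ given by $2\varrho(A_uv,w)=\varrho([u,v],w)+\varrho([w,u],v)+\varrho([w,v],u)$. $(\mathfrak g,r,\varrho)$ is a Riemann-Poisson Lie algebra if (i) $[r,r]=0$, and (ii) $r(A_\alpha\beta,\gamma)+r(\beta,A_\alpha\gamma)=0$ for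 all $\alpha,\beta,\gamma\in\mathfrak g^*$, where $A$ is the Levi-Civita product associated to $(\mathfrak g^*,[\,,]_r,\varrho^* )$ and $\varrho^*$ is the Euclidean product on $\mathfrak g^*$ induced by $\varrho$. *)

(* Defs.v *)
From HB Require Import structures.
From mathcomp Require Import all_boot all_order all_algebra.
From mathcomp Require Import sesquilinear reals ring lra.

Set Implicit Arguments.
Unset Strict Implicit.
Unset Printing Implicit Defensive.

Import Order.TTheory GRing.Theory Num.Theory.
Local Open Scope ring_scope.

HB.mixin Record Vector_isLieAlgebra (K : fieldType) g of Vector K g := {
  bracket : g -> g -> g;
  bracket_is_bilinear : bilinear_for *:%R *:%R bracket;
  bracketxx : forall u, bracket u u = 0;
  bracket_jacobi : forall u v w,
    bracket u (bracket v w) + bracket v (bracket w u)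
      + bracket w (bracket u v) = 0
}.

#[short(type="lieAlgType")]
HB.structure Definition LieAlgebra (K : fieldType) :=
  {g of Vector K g & Vector_isLieAlgebra K g}.

HB.instance Definition _ (K : fieldType) (g : lieAlgType K) :=
  bilinear_isBilinear.Build K g g g *:%R *:%R (@bracket K g)
    (@bracket_is_bilinear K g).

Lemma linfun_linear (K : fieldType) (U W : vectType K) (f : U -> W) :
  linear f -> linfun f =1 f.
Proof.
move=> f_lin; pose L := GRing.isLinear.Build K _ _ _ f f_lin.
exact: (lfunE (HB.pack f L : {linear U -> W})).
Qed.

Section EuclideanSpace.
Variables (R : realFieldType) (V : vectType R).
Implicit Types (u v w : V) (a b : 'Hom(V, R^o)).

(* These are total in rho and br so that they apply to any concrete form and
   bracket; rieszE and levi_civitaE give their meaning for a Euclidean rho and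
   a bilinear br. *)
Section Raw.
Variable rho : V -> V -> R.

(* V -> V^*, u |-> rho(u, .) *)
Definition flat : 'Hom(V, 'Hom(V, R^o)) :=
  linfun (fun u => linfun (rho u : V -> R^o)).

Definition riesz a : V := (flat^-1)%VF a.

Definition dual_dot a b : R := rho (riesz a) (riesz b).

Definition levi_civita (br : V -> V -> V) u v : V :=
  riesz (linfun (fun w => 2^-1 *
    (rho (br u v) w + rho (br w u) v + rho (br w v) u) : R^o)).

End Raw.

Section Theory.
Variable rho : {dot V for idfun}.

Lemma flatE u v : flat rho u v = rho u v.
Proof.
have flat_linear : linear (fun x => linfun (rho x : V -> R^o)).
  move=> c x y; apply/lfunP => z.
  by rewrite add_lfunE scale_lfunE !lfunE /= linearPl.
by rewrite /flat linfun_linear // lfunE.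
Qed.

Lemma rieszE a v : rho (riesz rho a) v = a v.
Proof.
have inj : lker (flat rho) == 0%VS.
  apply/eqP/vspaceP => u; rewrite memv_ker memv0; apply/eqP/eqP => [u0|->];
    last exact: linear0.
  apply/eqP; case: (eqVneq u 0) => // /(neq0_dnorm_gt0 (s := rho)).
  by rewrite -flatE u0 zero_lfunE ltxx.
have full : limg (flat rho) = fullv.
  apply/eqP; rewrite eqEdim subvf /= limg_dim_eq ?(eqP inj) ?capv0 //.
  by rewrite !dimvf /dim /= muln1.
rewrite -flatE /riesz limg_lfunVK //.
by rewrite full memvf.
Qed.

Lemma levi_civitaE (br : {bilinear V -> V -> V}) u v w :
  2 * rho (levi_civita rho br u v) w =
    rho (br u v) w + rho (br w u) v + rho (br w v) u.
Proof.
rewrite /levi_civita rieszE.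
rewrite linfun_linear => [|c x y]; first by rewrite mulrA divff ?mul1r ?pnatr_eq0.
by rewrite !(linearPl, linearPr) /GRing.scale /=; ring.
Qed.

Lemma riesz_linear : linear (riesz rho).
Proof. by move=> c a b; rewrite /riesz linearP. Qed.

Lemma dual_dot_bilinear : bilinear_for *%R (idfun \; *%R) (dual_dot rho).
Proof.
split=> [b c a a'|a c b b'].
  by rewrite /dual_dot riesz_linear linearPl.
rewrite /dual_dot riesz_linear; exact: linearPr.
Qed.

Lemma dual_dot_sym a b : dual_dot rho a b = (-1) ^+ false * idfun (dual_dot rho b a).
Proof. exact: hermitian_subproof. Qed.

Lemma dual_dot_pos a : a != 0 -> 0 < dual_dot rho a a.
Proof.
move=> a0; apply: (neq0_dnorm_gt0 (s := rho)); apply: contra_neq a0 => ra0.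
by apply/lfunP => v; rewrite -rieszE ra0 linear0l zero_lfunE.
Qed.

HB.instance Definition _ := bilinear_isBilinear.Build R _ _ _ _ _
  (dual_dot rho) dual_dot_bilinear.
HB.instance Definition _ := isHermitianSesquilinear.Build R _ false idfun
  (dual_dot rho) dual_dot_sym.
HB.instance Definition _ := isDotProduct.Build R _ (dual_dot rho) dual_dot_pos.

End Theory.
End EuclideanSpace.

Section Restriction.
Variables (R : realFieldType) (V : vectType R) (rho : {dot V for idfun}).
Variable U : {vspace V}.

Definition restr_dot (x y : subvs_of U) : R := rho (vsval x) (vsval y).

Lemma restr_dot_bilinear : bilinear_for *%R (idfun \; *%R) restr_dot.
Proof.
split=> [y c x x'|x c y y']; first by rewrite /restr_dot linearP linearPl.
by rewrite /restr_dot [vsval (_ + _)]linearP; exact: linearPr.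
Qed.

Lemma restr_dot_sym x y : restr_dot x y = (-1) ^+ false * idfun (restr_dot y x).
Proof. exact: hermitian_subproof. Qed.

Lemma restr_dot_pos x : x != 0 -> 0 < restr_dot x x.
Proof.
move=> x0; apply: (neq0_dnorm_gt0 (s := rho)); apply: contra_neq x0 => vx0.
exact: val_inj.
Qed.

HB.instance Definition _ := bilinear_isBilinear.Build R _ _ _ _ _
  restr_dot restr_dot_bilinear.
HB.instance Definition _ := isHermitianSesquilinear.Build R _ false idfun
  restr_dot restr_dot_sym.
HB.instance Definition _ := isDotProduct.Build R _ restr_dot restr_dot_pos.

(* The projection along the rho-orthogonal of U; vsproj alone projects along
   an arbitrary complement of U. *)
Definition orth_proj : 'Hom(V, subvs_of U) :=
  linfun (vsproj U \o daddv_pi U (orthov rho U)).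

Lemma orth_projP v u : u \in U -> rho (v - vsval (orth_proj v)) u = 0.
Proof.
move=> uU; set W := orthov rho U.
have UW0 : (U :&: W = 0)%VS.
  apply/eqP; rewrite -subv0; apply/subvP => x; rewrite memv_cap => /andP[xU].
  move/mem_orthovP/(_ x xU) => xx; rewrite memv0.
  by case: (eqVneq x 0) => // /(neq0_dnorm_gt0 (s := rho)); rewrite xx ltxx.
pose p := riesz restr_dot (linfun (fun x : subvs_of U => rho v (vsval x) : R^o)).
have vp : v - vsval p \in W.
  apply/mem_orthovP => x xU; rewrite linearBl.
  have := rieszE restr_dot
    (linfun (fun x : subvs_of U => rho v (vsval x) : R^o)) (vsproj U x).
  rewrite linfun_linear => [|c y z]; last first.
    by rewrite [vsval (_ + _)]linearP; exact: linearPr.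
  by rewrite /= /restr_dot -/p !vsprojK // => ->; rewrite subrr.
have vUW : v \in (U + W)%VS.
  by rewrite -(subrK (vsval p) v) addrC memv_add // subvsP.
rewrite /orth_proj lfunE /= vsprojK ?memv_pi //.
rewrite -[X in X - _](daddv_pi_add UW0 vUW) addrAC subrr add0r.
by have /mem_orthovP := memv_pi W U v; apply.
Qed.

End Restriction.

Section Poisson.
Variables (R : realFieldType) (g : lieAlgType R).
Implicit Types (u v w : g) (a b c : 'Hom(g, R^o)).

Definition coad u a : 'Hom(g, R^o) := linfun (fun v => - a (bracket u v)).

Lemma coadE u a v : coad u a v = - a (bracket u v).
Proof.
rewrite /coad linfun_linear // => k x y.
by rewrite linearPr linearP opprD scalerN.
Qed.

Section Bivector.
Variable r : {skew_symmetric 'Hom(g, R^o)}.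

(* r_# written in a basis (e_i) of g with dual basis (e_i^* ):
   r_#(a) = \sum_i r(a, e_i^* ) e_i; see rsharpE for its characterization. *)
Definition rsharp : 'Hom('Hom(g, R^o), g) :=
  linfun (fun a => \sum_(i < \dim {:g})
    r a (linfun (coord (vbasis {:g}) i : g -> R^o)) *: (vbasis {:g})`_i).

Lemma rsharpE a b : b (rsharp a) = r a b.
Proof.
rewrite /rsharp linfun_linear => [|k x y]; last first.
  rewrite scaler_sumr -big_split; apply: eq_bigr => i _ /=.
  by rewrite linearPl scalerDl scalerA.
rewrite linear_sum.
have {2}-> : b = \sum_(i < \dim {:g}) b (vbasis {:g})`_i *:
    (linfun (coord (vbasis {:g}) i : g -> R^o)).
  apply/lfunP => v; rewrite sum_lfunE {1}(coord_vbasis (memvf v)) linear_sum.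
  apply: eq_bigr => i _; rewrite linearZ scale_lfunE lfunE.
  by rewrite /GRing.scale /= mulrC.
rewrite linear_sumr; apply: eq_bigr => i _.
by rewrite linearZ linearZr_LR /= /GRing.scale /= mulrC.
Qed.

Definition schouten a b c : R :=
  a (bracket (rsharp b) (rsharp c)) + b (bracket (rsharp c) (rsharp a))
    + c (bracket (rsharp a) (rsharp b)).

Definition dual_bracket a b : 'Hom(g, R^o) :=
  coad (rsharp a) b - coad (rsharp b) a.

(* r evaluated on preimages under r_#; by omegaE the choice is irrelevant. *)
Definition omega (x y : subvs_of (limg rsharp)) : R :=
  r ((rsharp^-1)%VF (vsval x)) ((rsharp^-1)%VF (vsval y)).

Lemma omegaE x y a b :
  rsharp a = vsval x -> rsharp b = vsval y -> omega x y = r a b.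
Proof.
move=> ax by_; rewrite /omega.
have rV (z : subvs_of (limg rsharp)) : rsharp ((rsharp^-1)%VF (vsval z)) = vsval z
  by rewrite limg_lfunVK // subvsP.
have sk p q : r p q = - r q p by rewrite hermC /= expr1 mulN1r.
by rewrite -rsharpE rV -ax rsharpE sk -rsharpE rV -by_ rsharpE sk opprK.
Qed.

Lemma omega_nondeg x : (forall y, omega x y = 0) -> x = 0.
Proof.
move=> x0; apply: val_inj => /=.
have xV : rsharp ((rsharp^-1)%VF (vsval x)) = vsval x.
  by rewrite limg_lfunVK // subvsP.
have form0 b : b (vsval x) = 0.
  have yV : rsharp b = vsval (Subvs (memv_img rsharp (memvf b))) by [].
  by rewrite -xV rsharpE -(omegaE xV yV).
rewrite (coord_vbasis (memvf (vsval x))) big1 // => i _.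
have := form0 (linfun (coord (vbasis {:g}) i : g -> R^o)).
by rewrite lfunE /= => ->; rewrite scale0r.
Qed.

Section Metric.
Variable rho : {dot g for idfun}.

Definition is_riemann_poisson : Prop :=
  (forall a b c, schouten a b c = 0) /\
  let A := levi_civita (dual_dot rho) dual_bracket in
  forall a b c, r (A a b) c + r b (A a c) = 0.

End Metric.
End Bivector.

Section Subspace.
Variable U : {vspace g}.

Definition is_lie_subalgebra : Prop :=
  forall u v, u \in U -> v \in U -> bracket u v \in U.

(* vsproj is the identity on U, so this is the restriction of the bracket when
   U is a subalgebra; otherwise it is a junk value. *)
Definition restr_bracket (x y : subvs_of U) : subvs_of U :=
  vsproj U (bracket (vsval x) (vsval y)).

Definition is_kahler_lie_subalgebra (rho : {dot g for idfun})
    (w : subvs_of U -> subvs_of U -> R) : Prop :=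
  is_lie_subalgebra /\
  let nabla := levi_civita (restr_dot rho (U := U)) restr_bracket in
  forall s1 s2 s3, w (nabla s1 s2) s3 + w s2 (nabla s1 s3) = 0.

(* phi_U(s) = pr_W o ad_s restricted to W *)
Definition proj_ad (rho : {dot g for idfun}) (W : {vspace g})
    (s : subvs_of U) : 'End(subvs_of W) :=
  linfun (fun u : subvs_of W =>
    orth_proj rho W (bracket (vsval s) (vsval u))).

End Subspace.
End Poisson.

(* Main.v *)
From HB Require Import structures.
Require Import Defs.
From mathcomp Require Import all_boot all_order all_algebra.
From mathcomp Require Import sesquilinear reals ring lra.

(* Identify g^* with g through rho and put J := r_# o flat, a rho-skew
   endomorphism with image S and kernel S^perp.  Everything is then a trilinear
   identity in h x y z := rho(x, [y, z]).  On S, J intertwines the dual bracket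
   with the bracket of g as soon as [r, r] = 0, and both the Kaehler and the
   Poisson condition say that a Levi-Civita product commutes with J; by
   uniqueness of the Levi-Civita product, K(x, y, z) = G(J x, y, z) on S for the
   two Koszul forms, whence the equivalence there.  Splitting arguments along
   g = ker J + im J, the mixed components are conditions 2 and 3 and the fact
   that S is a subalgebra. *)

Set Implicit Arguments.
Unset Strict Implicit.
Unset Printing Implicit Defensive.

Import Order.TTheory GRing.Theory Num.Theory.
Local Open Scope ring_scope.

Lemma bracketC (K : fieldType) (g : lieAlgType K) (x y : g) :
  bracket x y = - bracket y x.
Proof.
have := bracketxx (x + y); rewrite linearDl !linearDr /= !bracketxx add0r addr0.
by move/eqP; rewrite addr_eq0 => /eqP.
Qed.

(** * Trilinear identities for an endomorphism [J], without reference to [r] *)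

Section KoszulForms.
Variables (R : realFieldType) (g : lieAlgType R) (rho : {dot g for idfun}).
Variable J : 'End(g).
Implicit Types x y z k : g.

Definition bracket_form x y z : R := rho x (bracket y z).
Local Notation h := bracket_form.

Lemma dotC x y : rho x y = rho y x.
Proof. by rewrite hermC /= expr0 mul1r. Qed.

Lemma bracket_formC x y z : h x y z = - h x z y.
Proof. by rewrite /h bracketC linearNr. Qed.

Lemma bracket_formDl x x' y z : h (x + x') y z = h x y z + h x' y z.
Proof. exact: linearDl. Qed.

Lemma bracket_formDm x y y' z : h x (y + y') z = h x y z + h x y' z.
Proof. by rewrite /h linearDl linearDr. Qed.

Lemma bracket_formDr x y z z' : h x y (z + z') = h x y z + h x y z'.
Proof. by rewrite /h !linearDr. Qed.

Lemma bracket_form0l y z : h 0 y z = 0. Proof. exact: linear0l. Qed.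
Lemma bracket_form0m x z : h x 0 z = 0.
Proof. by rewrite /h linear0l linear0r. Qed.
Lemma bracket_form0r x y : h x y 0 = 0.
Proof. by rewrite /h !linear0r. Qed.

Definition bracket_formD := (bracket_formDl, bracket_formDm, bracket_formDr).
Definition bracket_form0 := (bracket_form0l, bracket_form0m, bracket_form0r).

(* 2 rho(nabla_x y, z) for the Levi-Civita product nabla of g *)
Definition koszul x y z : R := h z x y + h y z x + h x z y.

(* [flat x, flat y]_r evaluated at z, when J = r_# o flat *)
Definition dual_bracket_form x y z : R := h x (J y) z - h y (J x) z.

Definition dual_koszul x y z : R :=
  dual_bracket_form x y z + dual_bracket_form z x y + dual_bracket_form z y x.

Definition schouten_form x y z : R :=
  h x (J y) (J z) + h y (J z) (J x) + h z (J x) (J y).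

(** For [rho]-skew [J] this is 2 rho((nabla_x J) y, z): it vanishes when nabla_x commutes with
    [J]. *)
Definition koszul_defect x y z : R := koszul x (J y) z + koszul x y (J z).

Definition dual_koszul_defect x y z : R :=
  dual_koszul x (J y) z + dual_koszul x y (J z).


(** Compatibility of the Levi-Civita product with [rho]. *)
Lemma koszulC x y z : koszul x y z = - koszul x z y.
Proof.
rewrite /koszul.
move: (bracket_formC z x y) (bracket_formC y z x) (bracket_formC x z y).
by lra.
Qed.

Lemma dual_koszulC x y z : dual_koszul x y z = - dual_koszul x z y.
Proof. by rewrite /dual_koszul /dual_bracket_form; lra. Qed.

(** Torsion-freeness of the Levi-Civita product. *)
Lemma koszul_torsion x y z : koszul x y z - koszul y x z = 2 * h z x y.
Proof.
rewrite /koszul.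
move: (bracket_formC z x y) (bracket_formC y z x) (bracket_formC x z y).
by lra.
Qed.

Lemma dual_koszul_torsion x y z :
  dual_koszul x y z - dual_koszul y x z = 2 * dual_bracket_form x y z.
Proof. by rewrite /dual_koszul /dual_bracket_form; lra. Qed.

(** By [koszulC] the six terms pair into three torsions. This is the fact that a parallel 2-form is
    closed; it recovers [r, r] = 0 from the Kähler condition. *)
Lemma koszul_defect_cyclic x y z :
  koszul_defect (J x) y z + koszul_defect (J y) z x + koszul_defect (J z) x y
  = 2 * schouten_form x y z.
Proof.
rewrite /koszul_defect /schouten_form.
move: (koszulC (J x) y (J z)) (koszulC (J y) z (J x)) (koszulC (J z) x (J y)).
move: (koszul_torsion (J x) (J y) z) (koszul_torsion (J y) (J z) x).
by move: (koszul_torsion (J z) (J x) y); lra.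
Qed.

(* Makes the two Koszul forms agree wherever the Kaehler defect vanishes. *)
Lemma dual_koszulE x y z :
  2 * (dual_koszul x y z - koszul (J x) y z) =
  koszul_defect y z x + koszul_defect z x y - koszul_defect x y z.
Proof.
rewrite /dual_koszul /dual_bracket_form /koszul_defect /koszul.
have := bracket_formC x y (J z); have := bracket_formC x z (J y).
have := bracket_formC y x (J z); have := bracket_formC y z (J x).
have := bracket_formC z x (J y); have := bracket_formC z y (J x).
have := bracket_formC (J x) y z; have := bracket_formC (J y) z x.
have := bracket_formC (J z) x y.
by lra.
Qed.

(** * From the Poisson condition to the Kähler condition on the image of [J] *)

Section DualToPrimal.
Hypothesis jac0 : forall x y z, schouten_form x y z = 0.
Hypothesis dual0 : forall x y z, dual_koszul_defect x y z = 0.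

(* As dual_koszul_defect = 0 means that the dual Levi-Civita product commutes
   with J, this is its torsion-freeness pushed forward by J. *)
Lemma dual_koszul_torsionJ x y z :
  dual_koszul x (J y) z - dual_koszul y (J x) z = 2 * h z (J x) (J y).
Proof.
move: (dual0 x y z) (dual0 y x z) (jac0 x y z).
rewrite /dual_koszul_defect /schouten_form.
move: (dual_koszul_torsion x y (J z)); rewrite /dual_bracket_form.
move: (bracket_formC x (J y) (J z)) (bracket_formC y (J x) (J z)).
by lra.
Qed.

(** Each bracket in [koszul] is a difference by [dual_koszul_torsionJ]; skewness in the last two
    arguments then cancels the terms led by [y] and by [z] and doubles the one led by [x]. *)
Lemma koszulJ x y z : koszul (J x) (J y) (J z) = dual_koszul x (J y) (J z).
Proof.
rewrite /koszul.
move: (dual_koszul_torsionJ x y (J z)) (dual_koszul_torsionJ z x (J y)).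
move: (dual_koszul_torsionJ z y (J x)).
move: (bracket_formC (J y) (J z) (J x)) (bracket_formC (J x) (J z) (J y)).
move: (bracket_formC (J z) (J x) (J y)).
move: (dual_koszulC x (J y) (J z)) (dual_koszulC y (J x) (J z)).
move: (dual_koszulC z (J x) (J y)).
by lra.
Qed.

Lemma koszul_defectJ x y z : koszul_defect (J x) (J y) (J z) = 0.
Proof. by rewrite /koszul_defect !koszulJ; exact: dual0. Qed.

End DualToPrimal.

(** * Splitting the identities along ker J and im J *)

Lemma schouten_form_cyclic x y z : schouten_form x y z = schouten_form y z x.
Proof. by rewrite /schouten_form; lra. Qed.

Lemma schouten_formDl x x' y z :
  schouten_form (x + x') y z = schouten_form x y z + schouten_form x' y z.
Proof. by rewrite /schouten_form !linearD !bracket_formD; lra. Qed.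

Lemma dual_koszul_defectC x y z :
  dual_koszul_defect x y z = - dual_koszul_defect x z y.
Proof.
rewrite /dual_koszul_defect (dual_koszulC x (J y)) (dual_koszulC x y).
by lra.
Qed.

Lemma dual_koszul_defectDl x x' y z : dual_koszul_defect (x + x') y z =
  dual_koszul_defect x y z + dual_koszul_defect x' y z.
Proof.
rewrite /dual_koszul_defect /dual_koszul /dual_bracket_form.
by rewrite !linearD !bracket_formD; lra.
Qed.

Lemma dual_koszul_defectDr x y z z' : dual_koszul_defect x y (z + z') =
  dual_koszul_defect x y z + dual_koszul_defect x y z'.
Proof.
rewrite /dual_koszul_defect /dual_koszul /dual_bracket_form.
by rewrite !linearD !bracket_formD; lra.
Qed.

Hypothesis ker_img : forall x, exists k y, J k = 0 /\ x = k + J y.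

Lemma ker_img_ind (F : g -> R) : {morph F : x y / x + y} ->
  (forall k, J k = 0 -> F k = 0) -> (forall x, F (J x) = 0) ->
  forall x, F x = 0.
Proof.
by move=> FD Fk FJ x; have [k [y [k0 ->]]] := ker_img x; rewrite FD Fk ?FJ ?addr0.
Qed.

Lemma dual_koszul_ker k x y : J k = 0 ->
  dual_koszul k x y = h k (J x) y - h k (J y) x + h y (J x) k - h x (J y) k.
Proof.
by move=> k0; rewrite /dual_koszul /dual_bracket_form !k0 !bracket_form0; lra.
Qed.

(** The four conditions say, in order: im J is a subalgebra, it is Kähler, condition 2, and
    condition 3 at [s1 = J (J x)], [s2 = J (J y)]. *)
Lemma riemann_poisson_split :
  (forall x y z, schouten_form x y z = 0) /\
    (forall x y z, dual_koszul_defect x y z = 0)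
  <->
  [/\ forall k x y, J k = 0 -> h k (J x) (J y) = 0,
      forall x y z, koszul_defect (J x) (J y) (J z) = 0,
      forall k k' x, J k = 0 -> J k' = 0 -> h k (J x) k' + h k' (J x) k = 0
    & forall k x y, J k = 0 -> h (J x) k (J (J y)) = h (J y) k (J (J x))].
Proof.
split=> [[jac0 dual0]|[sub0 defect0 kill symp]].
  have sub0 k x y : J k = 0 -> h k (J x) (J y) = 0.
    move=> k0; move: (jac0 k x y).
    by rewrite /schouten_form k0 !bracket_form0 !addr0.
  split=> // [|k k' x k0 k'0|k x y k0].
  - exact: koszul_defectJ.
  (* Only [J x] occurs, so [x] may be replaced by its image part [J w]; the dual defect at
     [(k, k', w)] then gives the claim. *)
  - have [k'' [w [k''0 ->]]] := ker_img x.
    rewrite linearD /= k''0 add0r; move: (dual0 k k' w).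
    rewrite /dual_koszul_defect !dual_koszul_ker // k'0 linear0 !bracket_form0.
    by lra.
  (* The terms paired with [k] vanish by [sub0]; the other two are condition 3. *)
  - move: (dual0 (J x) k y); rewrite /dual_koszul_defect.
    rewrite /dual_koszul /dual_bracket_form k0 linear0 !bracket_form0.
    move: (sub0 k (J x) y k0) (sub0 k (J y) x k0).
    move: (bracket_formC (J y) k (J (J x))).
    by move: (bracket_formC (J x) k (J (J y))); lra.
have jac0 x y z : schouten_form x y z = 0.
  have jack k u v : J k = 0 -> schouten_form k u v = 0.
    by move=> k0; rewrite /schouten_form k0 !bracket_form0 sub0 // !addr0.
  (* Cyclicity brings each argument in turn to the first place, until all three lie in the image. *)
  move: x; apply: ker_img_ind => [x x'|k k0|x]; [exact: schouten_formDl|exact: jack|].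
  rewrite schouten_form_cyclic.
  move: y; apply: ker_img_ind => [y y'|k k0|y]; [exact: schouten_formDl|exact: jack|].
  rewrite schouten_form_cyclic.
  move: z; apply: ker_img_ind => [z z'|k k0|z]; [exact: schouten_formDl|exact: jack|].
  by move: (koszul_defect_cyclic (J z) (J x) (J y)); rewrite !defect0; lra.
split=> //.
(* First the second argument in the kernel, hence also the third by skewness; then only the first;
   finally all three in the image. *)
have dualk x k z : J k = 0 -> dual_koszul_defect x k z = 0.
  move=> k0; move: x; apply: ker_img_ind => [x x'|k' k'0|x].
  - exact: dual_koszul_defectDl.
  - rewrite /dual_koszul_defect !dual_koszul_ker // k0 linear0 !bracket_form0.
    by move: (kill k k' (J z) k0 k'0); lra.
  - move: z; apply: ker_img_ind => [z z'|k' k'0|z].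
    + exact: dual_koszul_defectDr.
    + rewrite /dual_koszul_defect k0 k'0 /dual_koszul /dual_bracket_form k0.
      by rewrite linear0 !bracket_form0; lra.
    + rewrite /dual_koszul_defect /dual_koszul /dual_bracket_form k0 linear0.
      rewrite !bracket_form0.
      move: (sub0 k (J x) (J z) k0) (sub0 k (J (J z)) x k0) (symp k x (J z) k0).
      move: (bracket_formC (J (J z)) k (J (J x))).
      by move: (bracket_formC (J x) k (J (J (J z)))); lra.
move=> x y z.
have dualkr x' y' k : J k = 0 -> dual_koszul_defect x' y' k = 0.
  by move=> k0; rewrite dual_koszul_defectC dualk ?oppr0.
move: z; apply: ker_img_ind => [z z'|k k0|z];
  [exact: dual_koszul_defectDr|exact: dualkr|].
rewrite dual_koszul_defectC; apply/eqP; rewrite oppr_eq0; apply/eqP.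
move: y; apply: ker_img_ind => [y y'|k k0|y];
  [exact: dual_koszul_defectDr|exact: dualkr|].
move: x; apply: ker_img_ind => [x x'|k k0|x]; first exact: dual_koszul_defectDl.
  rewrite /dual_koszul_defect !dual_koszul_ker //.
  rewrite !sub0 //.
  (* The four surviving terms cancel in pairs, one pair for each instance of [symp]. *)
  move: (symp k (J z) y k0) (symp k z (J y) k0).
  move: (bracket_formC (J (J z)) k (J (J y))) (bracket_formC (J y) k (J (J (J z)))).
  move: (bracket_formC (J z) k (J (J (J y)))) (bracket_formC (J (J y)) k (J (J z))).
  by lra.
(* On image triples the right side of [dual_koszulE] vanishes, so the dual defect at [J x] becomes
   the Kähler defect at [J (J x)]. *)
have dualJ u v w : dual_koszul (J u) (J v) (J w) = koszul (J (J u)) (J v) (J w).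
  by move: (dual_koszulE (J u) (J v) (J w)); rewrite !defect0; lra.
by rewrite /dual_koszul_defect !dualJ; exact: defect0.
Qed.

End KoszulForms.

(** * The endomorphism [J] attached to [r], its kernel and its image *)

Section Translation.
Variables (R : realFieldType) (g : lieAlgType R).
Variables (r : {skew_symmetric 'Hom(g, R^o)}) (rho : {dot g for idfun}).
Implicit Types (x y z k : g) (a b c : 'Hom(g, R^o)).

Let S := limg (rsharp r).
Let J : 'End(g) := (rsharp r \o flat rho)%VF.

Lemma dot_inj x y : (forall z, rho x z = rho y z) -> x = y.
Proof.
move=> xy; apply/eqP; rewrite -subr_eq0.
case: (eqVneq (x - y) 0) => // /(neq0_dnorm_gt0 (s := rho)).
by rewrite linearBl /= xy subrr ltxx.
Qed.

Lemma flatK : cancel (flat rho) (riesz rho).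
Proof. by move=> x; apply: dot_inj => y; rewrite rieszE flatE. Qed.

Lemma rieszK : cancel (riesz rho) (flat rho).
Proof. by move=> a; apply/lfunP => y; rewrite flatE rieszE. Qed.

Lemma sharp_flatE x : J x = rsharp r (flat rho x).
Proof. by rewrite /J comp_lfunE. Qed.

Lemma dot_sharp_flat x y : rho (J x) y = r (flat rho x) (flat rho y).
Proof. by rewrite sharp_flatE dotC -flatE rsharpE. Qed.

Lemma skewC a b : r a b = - r b a.
Proof. by rewrite hermC /= expr1 mulN1r. Qed.

Lemma sharp_flat_skew x y : rho (J x) y = - rho x (J y).
Proof. by rewrite (dotC rho x) !dot_sharp_flat skewC. Qed.

Lemma mem_img_sharp x : reflect (exists y, x = J y) (x \in S).
Proof.
apply: (iffP memv_imgP) => [[a _ ->]|[y ->]].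
  by exists (riesz rho a); rewrite sharp_flatE rieszK.
by exists (flat rho y); rewrite ?memvf ?sharp_flatE.
Qed.

Lemma sharp_flat_in x : J x \in S.
Proof. by apply/mem_img_sharp; exists x. Qed.

(** Skewness moves [J] across [rho], which is nondegenerate. *)
Lemma mem_orthov_sharp k : (k \in orthov rho S) = (J k == 0).
Proof.
apply/mem_orthovP/eqP => [kS|k0 x /mem_img_sharp[y ->]].
  apply: dot_inj => y; rewrite sharp_flat_skew linear0l.
  by rewrite kS ?oppr0 // sharp_flat_in.
have := sharp_flat_skew k y; rewrite k0 linear0l => /esym/eqP.
by rewrite oppr_eq0 => /eqP.
Qed.

Lemma ker_img_sharp x : exists k y, J k = 0 /\ x = k + J y.
Proof.
have /mem_img_sharp[y py] := subvsP (orth_proj rho S x).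
exists (x - J y), y; split; last by rewrite subrK.
apply/eqP; rewrite -mem_orthov_sharp; apply/mem_orthovP => z zS.
by have := orth_projP rho x zS; rewrite py.
Qed.

Lemma img_sharpJ x : x \in S -> exists y, x = J (J y).
Proof.
move=> /mem_img_sharp[z ->]; have [k [y [k0 ->]]] := ker_img_sharp z.
by exists y; rewrite linearD /= k0 add0r.
Qed.

(** * The Riemann-Poisson condition in terms of [J] *)

Lemma schouten_flat x y z :
  schouten r (flat rho x) (flat rho y) (flat rho z) = schouten_form rho J x y z.
Proof. by rewrite /schouten !flatE -!sharp_flatE. Qed.

Lemma dual_dotE a z : dual_dot rho a (flat rho z) = a z.
Proof. by rewrite /dual_dot flatK rieszE. Qed.

Lemma dual_bracket_flat x y z :
  dual_bracket r (flat rho x) (flat rho y) z = dual_bracket_form rho J x y z.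
Proof.
rewrite /dual_bracket add_lfunE opp_lfunE !coadE !flatE -!sharp_flatE.
by rewrite /dual_bracket_form /bracket_form opprK addrC.
Qed.

Lemma dual_bracket_bilinear : bilinear_for *:%R *:%R (dual_bracket r).
Proof.
split=> [b c a a'|a c b b']; apply/lfunP => v; rewrite /dual_bracket;
  rewrite !(add_lfunE, opp_lfunE, scale_lfunE, coadE) !linearP !linearPl /=;
  rewrite ?(add_lfunE, scale_lfunE) ?linearP /GRing.scale /=; ring.
Qed.

HB.instance Definition _ := bilinear_isBilinear.Build R _ _ _ _ _
  (dual_bracket r) dual_bracket_bilinear.

(** Pairing by [r] is pairing by [rho] after [J]; moving [J] to the other side produces the sign and
    the argument [J z]. *)
Lemma dual_levi_civita x y z :
  2 * r (levi_civita (dual_dot rho) (dual_bracket r) (flat rho x) (flat rho y))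
        (flat rho z) = - dual_koszul rho J x y (J z).
Proof.
set a := levi_civita _ _ _ _.
rewrite -(rieszK a) -dot_sharp_flat sharp_flat_skew rieszE -dual_dotE mulrN.
by rewrite levi_civitaE /dual_koszul -!dual_bracket_flat -!dual_dotE.
Qed.

(** Every covector is some [flat rho x], and twice the Poisson expression is minus the dual
    defect. *)
Lemma is_riemann_poissonE : is_riemann_poisson r rho <->
  (forall x y z, schouten_form rho J x y z = 0) /\
  (forall x y z, dual_koszul_defect rho J x y z = 0).
Proof.
split=> [[jac0 lc0]|[jac0 lc0]].
  split=> x y z; first by rewrite -schouten_flat.
  move: (lc0 (flat rho x) (flat rho y) (flat rho z)).
  rewrite (skewC (flat rho y)).
  move: (dual_levi_civita x y z) (dual_levi_civita x z y).
  rewrite /dual_koszul_defect; move: (dual_koszulC rho J x z (J y)).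
  by lra.
split=> [a b c|A a b c].
  by rewrite -(rieszK a) -(rieszK b) -(rieszK c) schouten_flat.
rewrite -(rieszK a) -(rieszK b) -(rieszK c).
move: (riesz rho a) (riesz rho b) (riesz rho c) => x y z.
rewrite (skewC (flat rho y)).
rewrite /A; move: (dual_levi_civita x y z) (dual_levi_civita x z y) (lc0 x y z).
rewrite /dual_koszul_defect; move: (dual_koszulC rho J x z (J y)).
by lra.
Qed.

(** * The three conditions of the theorem in terms of [J] *)

Lemma omega_dot (s t : subvs_of S) y :
  vsval t = J y -> omega s t = rho (vsval s) y.
Proof.
have /mem_img_sharp[x sx] := subvsP s => ty.
rewrite (@omegaE _ _ r s t (flat rho x) (flat rho y)) -?sharp_flatE //.
by rewrite sx dot_sharp_flat.
Qed.

Lemma omegaC (s t : subvs_of S) : omega s t = - omega t s.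
Proof. exact: skewC. Qed.

Lemma mem_img_sharp_orth x :
  x \in S <-> forall k, J k = 0 -> rho k x = 0.
Proof.
split=> [xS k /eqP|xk].
  by rewrite -mem_orthov_sharp => /mem_orthovP/(_ x xS).
have [k [y [k0 xky]]] := ker_img_sharp x.
(* The kernel part [k] is orthogonal to [x] by assumption and to [J y] by skewness, hence to
   itself. *)
have kk : rho k k = 0.
  move: (xk k k0); rewrite xky linearDr /=.
  have := sharp_flat_skew k y; rewrite k0 linear0l.
  by move/esym/eqP; rewrite oppr_eq0 => /eqP ->; rewrite addr0.
have k00 : k = 0.
  by case: (eqVneq k 0) => // /(neq0_dnorm_gt0 (s := rho)); rewrite kk ltxx.
by rewrite xky k00 add0r sharp_flat_in.
Qed.

Lemma is_lie_subalgebraE : is_lie_subalgebra S <->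
  forall k x y, J k = 0 -> bracket_form rho k (J x) (J y) = 0.
Proof.
split=> [sub k x y k0|sub x y].
  by have /mem_img_sharp_orth := sub _ _ (sharp_flat_in x) (sharp_flat_in y); apply.
move=> /mem_img_sharp[u ->] /mem_img_sharp[v ->].
by apply/mem_img_sharp_orth => k k0; exact: sub.
Qed.

Lemma restr_bracket_bilinear (U : {vspace g}) :
  bilinear_for *:%R *:%R (@restr_bracket R g U).
Proof.
split=> [y c x x'|x c y y']; rewrite /restr_bracket.
  by rewrite [vsval (_ + _)]linearP linearPl linearP.
by rewrite [vsval (_ + _)]linearP linearPr linearP.
Qed.

HB.instance Definition _ (U : {vspace g}) :=
  bilinear_isBilinear.Build R _ _ _ _ _
    (@restr_bracket R g U) (restr_bracket_bilinear U).

Lemma restr_levi_civita (U : {vspace g}) (s t u : subvs_of U) :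
  is_lie_subalgebra U ->
  2 * rho (vsval (levi_civita (restr_dot rho (U := U)) (@restr_bracket R g U) s t))
          (vsval u) = koszul rho (vsval s) (vsval t) (vsval u).
Proof.
move=> subU.
have brE (x y : subvs_of U) :
    vsval (restr_bracket x y) = bracket (vsval x) (vsval y).
  by rewrite /restr_bracket vsprojK // subU ?subvsP.
rewrite -[rho _ _]/(restr_dot rho _ u) levi_civitaE.
by rewrite /koszul /bracket_form -!brE; congr (_ + _ + _); exact: dotC.
Qed.

Lemma is_kahler_lie_subalgebraE :
  is_kahler_lie_subalgebra rho (omega (r := r)) <->
  (forall k x y, J k = 0 -> bracket_form rho k (J x) (J y) = 0) /\
  (forall x y z, koszul_defect rho J (J x) (J y) (J z) = 0).
Proof.
(* Double preimages keep [J y] and [J z] in [S]: [omega_dot] turns [omega] into [rho] against them,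
   and [restr_levi_civita] tests only against vectors of [S]. *)
have defectE (s1 s2 s3 : subvs_of S) y z : is_lie_subalgebra S ->
    vsval s2 = J (J y) -> vsval s3 = J (J z) ->
    let nabla := levi_civita (restr_dot rho (U := S)) (@restr_bracket R g S) in
    2 * (omega (nabla s1 s2) s3 + omega s2 (nabla s1 s3)) =
    koszul_defect rho J (vsval s1) (J y) (J z).
  move=> sub s2y s3z nabla.
  rewrite (omegaC s2) (omega_dot _ s2y) (omega_dot _ s3z).
  move: (restr_levi_civita s1 s2 (Subvs (sharp_flat_in z)) sub).
  move: (restr_levi_civita s1 s3 (Subvs (sharp_flat_in y)) sub).
  rewrite /koszul_defect /= -/nabla s2y s3z.
  by move: (koszulC rho (vsval s1) (J y) (J (J z))); lra.
split=> [[sub par]|[sub0 defect0]].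
  split=> [|x y z]; first exact/is_lie_subalgebraE.
  rewrite -[J x]/(vsval (Subvs (sharp_flat_in x))).
  rewrite -(defectE _ (Subvs (sharp_flat_in (J y))) (Subvs (sharp_flat_in (J z)))) //.
  by rewrite par mulr0.
have sub : is_lie_subalgebra S by exact/is_lie_subalgebraE.
split=> // nabla s1 s2 s3.
have /mem_img_sharp[x s1x] := subvsP s1.
have [y s2y] := img_sharpJ (subvsP s2); have [z s3z] := img_sharpJ (subvsP s3).
move: (defectE s1 s2 s3 y z sub s2y s3z); rewrite s1x defect0.
by move/eqP; rewrite mulf_eq0 pnatr_eq0 => /eqP.
Qed.

(** What the orthogonal projection removes pairs to zero with [W]. *)
Lemma dot_proj_ad (U W : {vspace g}) (s : subvs_of U) (u v : subvs_of W) :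
  rho (vsval (proj_ad rho W s u)) (vsval v) =
  bracket_form rho (vsval v) (vsval s) (vsval u).
Proof.
rewrite /proj_ad linfun_linear => [|c x y]; last first.
  by rewrite [vsval (_ + _)]linearP linearPr linearP.
have /eqP := orth_projP rho (bracket (vsval s) (vsval u)) (subvsP v).
rewrite linearBl subr_eq0 => /eqP projE.
rewrite /bracket_form (dotC _ (vsval v)); exact: esym.
Qed.

Lemma proj_ad_skewE :
  (forall (s : subvs_of S) (u v : subvs_of (orthov rho S)),
    rho (vsval (proj_ad rho (orthov rho S) s u)) (vsval v) +
    rho (vsval u) (vsval (proj_ad rho (orthov rho S) s v)) = 0) <->
  (forall k k' x, J k = 0 -> J k' = 0 ->
    bracket_form rho k (J x) k' + bracket_form rho k' (J x) k = 0).
Proof.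
split=> [skew k k' x k0 k'0|skew s u v].
  have kS : k \in orthov rho S by rewrite mem_orthov_sharp k0.
  have k'S : k' \in orthov rho S by rewrite mem_orthov_sharp k'0.
  move: (skew (Subvs (sharp_flat_in x)) (Subvs k'S) (Subvs kS)).
  by rewrite dot_proj_ad dotC dot_proj_ad.
have /mem_img_sharp[x sx] := subvsP s.
rewrite dot_proj_ad dotC dot_proj_ad sx.
by apply: skew; apply/eqP; rewrite -mem_orthov_sharp subvsP.
Qed.

Lemma proj_ad_symplecticE :
  (forall (s1 s2 : subvs_of S) (u : subvs_of (orthov rho S)),
    omega (proj_ad rho S u s1) s2 + omega s1 (proj_ad rho S u s2) = 0) <->
  (forall k x y, J k = 0 ->
    bracket_form rho (J x) k (J (J y)) = bracket_form rho (J y) k (J (J x))).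
Proof.
(* Double preimages again, since [dot_proj_ad] needs [J x] and [J y] as vectors of [S]. *)
have symE (s1 s2 : subvs_of S) (u : subvs_of (orthov rho S)) x y :
    vsval s1 = J (J x) -> vsval s2 = J (J y) ->
    omega (proj_ad rho S u s1) s2 + omega s1 (proj_ad rho S u s2) =
    bracket_form rho (J y) (vsval u) (J (J x)) -
    bracket_form rho (J x) (vsval u) (J (J y)).
  move=> s1x s2y; rewrite (omegaC s1) (omega_dot _ s1x) (omega_dot _ s2y).
  rewrite -[J x]/(vsval (Subvs (sharp_flat_in x))).
  rewrite -[J y]/(vsval (Subvs (sharp_flat_in y))) !dot_proj_ad.
  by rewrite s1x s2y.
split=> [sym k x y k0|sym s1 s2 u].
  have kS : k \in orthov rho S by rewrite mem_orthov_sharp k0.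
  move: (sym (Subvs (sharp_flat_in (J x))) (Subvs (sharp_flat_in (J y))) (Subvs kS)).
  by rewrite (symE _ _ _ x y) //= => /eqP; rewrite subr_eq0 => /eqP.
have [x s1x] := img_sharpJ (subvsP s1); have [y s2y] := img_sharpJ (subvsP s2).
rewrite (symE _ _ _ x y) // (sym _ y x) ?subrr //.
by apply/eqP; rewrite -mem_orthov_sharp subvsP.
Qed.

End Translation.

Theorem theorem3p1 (R : realType) (g : lieAlgType R)
    (r : {skew_symmetric 'Hom(g, R^o)}) (rho : {dot g for idfun}) :
  let S := limg (rsharp r) in
  let Sperp := orthov rho S in
  let omega_r := omega (r := r) in
  let phiS : subvs_of S -> 'End(subvs_of Sperp) := proj_ad rho Sperp in
  let phiSperp : subvs_of Sperp -> 'End(subvs_of S) := proj_ad rho S in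
  is_riemann_poisson r rho <->
  [/\ is_kahler_lie_subalgebra rho omega_r,
      forall (s : subvs_of S) (u v : subvs_of Sperp),
        rho (vsval (phiS s u)) (vsval v) + rho (vsval u) (vsval (phiS s v)) = 0
    & forall (s1 s2 : subvs_of S) (u : subvs_of Sperp),
        omega_r (phiSperp u s1) s2 + omega_r s1 (phiSperp u s2) = 0].
Proof.
move=> S Sperp omega_r phiS phiSperp.
apply: (iff_trans (is_riemann_poissonE r rho)).
apply: (iff_trans (riemann_poisson_split rho (ker_img_sharp r rho))).
split=> [[sub0 defect0 kill sym]|[kahler /proj_ad_skewE skew /proj_ad_symplecticE sym]].
  split; first exact/is_kahler_lie_subalgebraE.
    exact/proj_ad_skewE.
  exact/proj_ad_symplecticE.
by have [sub0 defect0] := (is_kahler_lie_subalgebraE r rho).1 kahler; split.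
Qed.
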